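(* Let $\Omega_1$ and $\Omega_2$ be convex subsets of a real locally convex topological vector space $X$. Suppose that $\operatorname{iri}(\Omega_1)\ne\emptyset$, $\operatorname{iri}(\Omega_2)\ne\emptyset$, and $\Omega_1-\Omega_2$ is quasi-regular. Then $$\operatorname{qri}(\Omega_1-\Omega_2)=\operatorname{qri}(\Omega_1)-\operatorname{qri}(\Omega_2).$$
   Context: For subsets $A,B$ of a vector space, $A-B:=\{a-b\mid a\in A,\ b\in B\}$. For a nonempty subset $A$ of a real locally convex topological vector space $X$, $\operatorname{cone}(A):=\{ta\mid t\ge 0,\ a\in A\}$ and $\overline{\operatorname{cone}}(A)$ is its closure. For a nonempty convex set $\Omega\subset X$, the intrinsic relative interior is $\operatorname{iri}(\Omega):=\{x\in\Omega\mid \operatorname{cone}(\Omega-x)\text{ is a linear subspace of }X\}$ and the quasi-relative interior is $\operatorname{qri}(\Omega):=\{x\in\Omega\mid \overline{\operatorname{cone}}(\Omega-x)\text{ is a linear subspace of }X\}$; by convention $\operatorname{iri}(\emptyset)=\operatorname{qri}(\emptyset)=\emptyset$. A convex set $\Omega$ is called quasi-regular if $\operatorname{qri}(\Omega)=\operatorname{iri}(\Omega)$. *)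

(* Defs.v *)
From HB Require Import structures.
From mathcomp Require Import all_boot all_order all_algebra.
From mathcomp Require Import all_classical all_reals all_analysis.

Set Implicit Arguments.
Unset Strict Implicit.
Unset Printing Implicit Defensive.

Import Order.TTheory GRing.Theory Num.Theory.

Local Open Scope classical_set_scope.
Local Open Scope ring_scope.

(* A - B in the sense of Minkowski, not the set-theoretic difference A `\` B. *)
Definition set_sub (V : zmodType) (A B : set V) : set V :=
  [set a - b | a in A & b in B].

Definition cone (R : realType) (V : lmodType R) (A : set V) : set V :=
  [set t *: a | t in [set t : R | 0 <= t] & a in A].

Definition is_linear_subspace (R : realType) (V : lmodType R) (A : set V) :
  Prop := submod_closed (mem A).

(* iri and qri are meant for convex sets. Both are empty on set0, as the usual
   convention requires. *)
Definition iri (R : realType) (X : lmodType R) (Omega : set X) : set X :=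
  [set x | Omega x /\ is_linear_subspace (cone [set w - x | w in Omega])].

Definition qri (R : realType) (X : tvsType R) (Omega : set X) : set X :=
  [set x | Omega x /\
     is_linear_subspace (closure (cone [set w - x | w in Omega]))].

Definition quasi_regular (R : realType) (X : tvsType R) (Omega : set X) :
  Prop := qri Omega = iri Omega.

(* Main.v *)
Require Import Defs.
From HB Require Import structures.
From mathcomp Require Import all_boot all_order all_algebra.
From mathcomp Require Import all_classical all_reals all_analysis.
From mathcomp Require Import ring lra.

(** Two inclusions are combined.  First, [qri A - qri B] lies in [qri (A - B)]
    for all convex [A] and [B]: the closed cone of [A - B] at [a - b] contains
    the closed cone of [A] at [a] and the opposite of that of [B] at [b], and
    it is a subspace because both of these are.  Secondly, [iri (A - B)] lies
    in [iri A - iri B] as soon as [iri A] and [iri B] are nonempty: for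
    [a0 \in iri A] and [b0 \in iri B], a point [x \in iri (A - B)] is strictly
    between [a0 - b0] and some [a1 - b1], hence the difference of a point
    strictly between [a0] and [a1] and one strictly between [b0] and [b1], and
    such points are in [iri A] and [iri B].  Quasi-regularity closes the loop,
    since [iri] is always contained in [qri]. *)

Set Implicit Arguments.
Unset Strict Implicit.
Unset Printing Implicit Defensive.

Import Order.TTheory GRing.Theory Num.Theory.

Local Open Scope classical_set_scope.
Local Open Scope ring_scope.

(** The clause of [is_linear_subspaceP] with [a] restricted to nonnegative scalars, so that only
    closure under opposites separates a convex cone from a subspace. *)
Definition convex_cone (R : realType) (V : lmodType R) (K : set V) : Prop :=
  K 0 /\ forall (a : R) (u v : V), 0 <= a -> K u -> K v -> K (a *: u + v).

Section Algebra.
Context {R : realType} {V : lmodType R}.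
Implicit Types (A B K : set V) (x y w u v : V).

Lemma convex_setP A : convex_set A <->
  forall x y (t : R), 0 <= t <= 1 -> A x -> A y -> A (t *: x + (1 - t) *: y).
Proof.
split=> [cA x y t /andP[t0 t1] Ax Ay|cA x y t].
  have := cA x y (Itv01 t0 t1); rewrite !inE => /(_ Ax Ay).
  by [].
rewrite !inE => Ax Ay; apply: cA => //.
by rewrite ge0 le1.
Qed.

Lemma is_linear_subspaceP K : is_linear_subspace K <->
  K 0 /\ forall (a : R) u v, K u -> K v -> K (a *: u + v).
Proof.
split=> -[K0 Kl]; split.
- by rewrite in_setE in K0.
- by move=> a u v Ku Kv; have := Kl a u v; rewrite !in_setE; apply.
- by rewrite in_setE.
- by move=> a u v; rewrite !in_setE; apply: Kl.
Qed.

Lemma is_linear_subspace_opp K u : is_linear_subspace K -> K u -> K (- u).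
Proof.
by move=> /is_linear_subspaceP[K0 Kl] Ku; rewrite -scaleN1r -[_ *: _]addr0; exact: Kl.
Qed.

Lemma convex_cone_subspace K : convex_cone K ->
  (forall u, K u -> K (- u)) -> is_linear_subspace K.
Proof.
move=> [K0 Kl] KN; apply/is_linear_subspaceP; split=> // a u v Ku Kv.
have [a0|a0] := leP 0 a; first exact: Kl.
rewrite -[a]opprK scaleNr -scalerN; apply: Kl => //; last exact: KN.
by rewrite oppr_ge0 ltW.
Qed.

Lemma cone_sub A x w : A w -> cone [set w - x | w in A] (w - x).
Proof. by move=> Aw; exists 1 => //=; exists (w - x); [exists w|rewrite scale1r]. Qed.

Lemma convex_cone_cone A x : convex_set A -> A x ->
  convex_cone (cone [set w - x | w in A]).
Proof.
move=> /convex_setP cA Ax; split.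
  by rewrite -(subrr x); exact: cone_sub.
move=> a _ _ a0 [s /= s0 [_ [v Av <-] <-]] [t /= t0 [_ [w Aw <-] <-]].
have as0 : 0 <= a * s by rewrite mulr_ge0.
have [r0|r0] := eqVneq (a * s + t) 0.
  have -> : t = 0 by lra.
  have as00 : a * s = 0 by lra.
  by rewrite scalerA as00 !scale0r addr0 -(subrr x); exact: cone_sub.
have r_gt0 : 0 < a * s + t by rewrite lt_neqAle eq_sym r0 addr_ge0.
(* Dividing the weights [a * s] and [t] by their sum [r] turns the combination into [r] times a
   convex combination of [v] and [w], minus [x]. *)
set r := a * s + t in r0 r_gt0 *.
exists r; first exact: ltW.
exists ((a * s / r) *: v + (1 - a * s / r) *: w - x).
  exists ((a * s / r) *: v + (1 - a * s / r) *: w) => //.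
  apply: cA => //; apply/andP; split; first by rewrite divr_ge0// ltW.
  by rewrite ler_pdivrMr// mul1r lerDl.
rewrite scalerA scalerBr scalerDr !scalerA.
have -> : r * (a * s / r) = a * s by field.
have -> : r * (1 - a * s / r) = t by rewrite /r; field.
by rewrite !scalerBr /r scalerDl opprD addrACA.
Qed.

Lemma convex_set_sub A B : convex_set A -> convex_set B ->
  convex_set (set_sub A B).
Proof.
move=> /convex_setP cA /convex_setP cB; apply/convex_setP.
move=> _ _ t t01 [a Aa [b Bb <-]] [c Ac [d Bd <-]].
exists (t *: a + (1 - t) *: c); first exact: cA.
exists (t *: b + (1 - t) *: d); first exact: cB.
by rewrite !scalerBr opprD addrACA.
Qed.

(** The cone at [x] is a convex cone, hence a subspace once it contains the opposite of each
    [w - x]. An equation [x - w = s *: (v - x)] with [0 < s] puts [x] strictly between [w] and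
    [v]. *)
Lemma iriP A x : convex_set A -> (iri A x <-> A x /\ forall w, A w ->
  exists2 v, A v & exists2 t : R, 0 < t < 1 & x = t *: w + (1 - t) *: v).
Proof.
move=> cA; split=> -[Ax].
  move=> K; split=> // w Aw.
  have [s /= s0 [_ [v Av <-]]] := is_linear_subspace_opp K (cone_sub x Aw).
  rewrite opprB => /esym/eqP; rewrite subr_eq => /eqP xE.
  (* If [s = 0] then [w = x], and the segment degenerates to the point [x]. *)
  have [sE|sn0] := eqVneq s 0.
    exists x => //; exists 2^-1; first lra.
    rewrite sE scale0r add0r in xE.
    by rewrite -xE -scalerDl addrC subrK scale1r.
  exists v => //; exists (1 + s)^-1.
    rewrite invr_gt0 invf_lt1; lra.
  have s1 : 1 + s != 0 by lra.
  apply: (scalerI s1).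
  rewrite scalerDr !scalerA mulfV// scale1r mulrBr mulr1 mulfV//.
  by rewrite scalerDl scale1r {1}xE scalerBr addrAC subrK [1 + s]addrC addrK addrC.
move=> Aseg; split=> //.
apply: convex_cone_subspace; first exact: convex_cone_cone.
move=> _ [s /= s0 [_ [w Aw <-] <-]].
have [v Av [t /andP[t0 t1] xE]] := Aseg w Aw.
(* Here [v - x] and [w - x] are [- t] and [1 - t] times [w - v]. *)
exists (s * ((1 - t) / t)).
  by rewrite /= mulr_ge0// divr_ge0; lra.
exists (v - x); first by exists v.
have {}xE : x = v + t *: (w - v).
  by rewrite xE scalerBl scale1r scalerBr addrCA.
have -> : v - x = - t *: (w - v) by rewrite xE opprD addrA subrr add0r scaleNr.
have -> : w - x = (1 - t) *: (w - v).
  by rewrite xE opprD addrA scalerBl scale1r.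
rewrite !scalerA -scaleNr; congr (_ *: _).
by field; lra.
Qed.

Lemma iri_segment A x y (t : R) : convex_set A -> iri A x -> A y ->
  0 < t < 1 -> iri A (t *: x + (1 - t) *: y).
Proof.
move=> cA /(iriP _ cA)[Ax xA] Ay /andP[t0 t1].
have /convex_setP cA' := cA; apply/iriP => //; split.
  by apply: cA' => //; lra.
move=> w Aw; have [u Au [s /andP[s0 s1] xE]] := xA w Aw.
have ts0 : 0 < t * s by rewrite mulr_gt0.
have ts1 : t * s < 1 by nra.
(* Substituting [x = s *: w + (1 - s) *: u] gives [w] the weight [t * s]; the terms in [u] and [y]
   are merged into one point of [A] of weight [1 - t * s]. *)
exists ((t * (1 - s) / (1 - t * s)) *: u + (1 - t * (1 - s) / (1 - t * s)) *: y).
  apply: cA' => //; rewrite divr_ge0//= ?mulr_ge0 ?ler_pdivrMr ?mul1r; nra.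
exists (t * s); first by rewrite ts0.
have n0 : 1 - t * s != 0 by lra.
rewrite xE !scalerDr !scalerA -addrA; congr (_ *: _ + (_ *: _ + _ *: _)); field => //.
Qed.

Lemma iri_set_sub A B : convex_set A -> convex_set B ->
  iri A !=set0 -> iri B !=set0 ->
  iri (set_sub A B) `<=` set_sub (iri A) (iri B).
Proof.
move=> cA cB [a0 iA] [b0 iB] x /(iriP _ (convex_set_sub cA cB))[_].
case: (iA) (iB) => [Aa0 _] [Bb0 _].
have AB0 : set_sub A B (a0 - b0) by exists a0 => //; exists b0.
move=> /(_ _ AB0)[_ [a1 Aa1 [b1 Bb1 <-]] [t t01 ->]].
exists (t *: a0 + (1 - t) *: a1); first exact: iri_segment.
exists (t *: b0 + (1 - t) *: b1); first exact: iri_segment.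
by rewrite !scalerBr opprD addrACA.
Qed.

End Algebra.

Section Topology.
Context {R : realType} {X : tvsType R}.
Implicit Types (A B K : set X).

(** This is joint continuity of [a *: u + v] in [u] and [v]. Keeping three sets apart allows [K2 =
    [set 0]], which yields maps of one variable such as negation. *)
Lemma closure_lincomb (a : R) (K1 K2 K : set X) :
  (forall u v, K1 u -> K2 v -> K (a *: u + v)) ->
  forall u v, closure K1 u -> closure K2 v -> closure K (a *: u + v).
Proof.
move=> KP u v clu clv U nU.
have cont : continuous (fun z : X * X => a *: z.1 + z.2).
  move=> z; apply: (@continuous_comp _ _ _ (fun z : X * X => (a *: z.1, z.2))
    (fun z : X * X => z.1 + z.2)); last exact: add_continuous.
  apply: cvg_pair; last exact: cvg_snd.
  apply: (@continuous_comp _ _ _ (fun z : X * X => (a : R^o, z.1))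
    (fun z : R^o * X => z.1 *: z.2)); last exact: scale_continuous.
  by apply: (@cvg_pair _ _ _ _ (nbhs (a : R^o))); [exact: cvg_cst|exact: cvg_fst].
have [[P Q] [/= nP nQ] PQ] := cont (u, v) _ nU.
have [u' [Ku' Pu']] := clu _ nP; have [v' [Kv' Qv']] := clv _ nQ.
by exists (a *: u' + v'); split; [exact: KP|exact: (PQ (u', v'))].
Qed.

Lemma closure_closure K : closure (closure K) = closure K.
Proof. by rewrite -(closure_id _).1//; exact: closed_closure. Qed.

Lemma closure_convex_cone K : convex_cone K -> convex_cone (closure K).
Proof.
move=> [K0 Kl]; split; first exact: subset_closure.
by move=> a u v a0; apply: closure_lincomb => ? ?; exact: Kl.
Qed.

Lemma closure_linear_subspace K :
  is_linear_subspace K -> is_linear_subspace (closure K).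
Proof.
move=> /is_linear_subspaceP[K0 Kl]; apply/is_linear_subspaceP; split.
  exact: subset_closure.
by move=> a u v; apply: closure_lincomb => ? ?; exact: Kl.
Qed.

Lemma iri_sub_qri A : iri A `<=` qri A.
Proof. by move=> x [Ax K]; split=> //; exact: closure_linear_subspace. Qed.

Lemma qri_set_sub A B : convex_set A -> convex_set B ->
  set_sub (qri A) (qri B) `<=` qri (set_sub A B).
Proof.
move=> cA cB _ [a [Aa LA] [b [Bb LB] <-]].
have ABab : set_sub A B (a - b) by exists a => //; exists b.
split=> //.
set K := cone _.
have KC : convex_cone (closure K).
  apply: closure_convex_cone; apply: convex_cone_cone => //.
  exact: convex_set_sub.
(* Fixing the second point at [b]: [w - a = (w - b) - (a - b)]. *)
have KA u : closure (cone [set w - a | w in A]) u -> closure K u.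
  apply: closureS => _ [s /= s0 [_ [w Aw <-] <-]]; exists s => //.
  exists (w - b - (a - b)); last by rewrite opprB addrA subrK.
  by exists (w - b) => //; exists w => //; exists b.
(* Fixing the first point at [a]: [- (w - b) = (a - w) - (a - b)]. *)
have KB u : closure (cone [set w - b | w in B]) u -> closure K (- u).
  move=> Bu; rewrite -scaleN1r -[_ *: _]addr0.
  apply: (closure_lincomb (K2 := [set 0]) _ Bu); last exact: subset_closure.
  move=> _ _ [s /= s0 [_ [w Bw <-] <-]] ->; exists s => //.
  exists (a - w - (a - b)); first by exists (a - w) => //; exists a => //; exists w.
  rewrite addr0 scaleN1r -scalerN; congr (_ *: _).
  by rewrite !opprB addrC addrA subrK.
apply: convex_cone_subspace => // u clu.
(* By continuity of negation it suffices to send [K] itself into [closure K]. *)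
rewrite -closure_closure -scaleN1r -[_ *: _]addr0.
apply: (closure_lincomb (K2 := [set 0]) _ clu); last exact: subset_closure.
move=> _ _ [s /= s0 [_ [_ [c Ac [d Bd <-]] <-] <-]] ->.
(* The opposite splits into an [A] part and a [B] part; [LA] and [LB] allow the sign changes that
   [KA] and [KB] require. *)
have -> : - 1 *: (s *: (c - d - (a - b))) + 0 =
          1 *: (- (s *: (c - a))) - - (s *: (d - b)).
  rewrite addr0 scaleN1r scale1r -opprD -scalerBr; congr (- (_ *: _)).
  by rewrite !opprD addrACA.
have cA0 : cone [set w - a | w in A] (s *: (c - a)).
  by exists s => //; exists (c - a) => //; exists c.
have cB0 : cone [set w - b | w in B] (s *: (d - b)).
  by exists s => //; exists (d - b) => //; exists d.
apply: KC.2 => //.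
  by apply: KA; apply: (is_linear_subspace_opp LA); exact: subset_closure.
by apply: KB; apply: (is_linear_subspace_opp LB); exact: subset_closure.
Qed.

End Topology.

Theorem corollary5p2 (R : realType) (X : tvsType R) (Omega1 Omega2 : set X)
  (cvx1 : convex_set Omega1) (cvx2 : convex_set Omega2)
  (iri1 : iri Omega1 !=set0) (iri2 : iri Omega2 !=set0)
  (qreg : quasi_regular (set_sub Omega1 Omega2)) :
  qri (set_sub Omega1 Omega2) = set_sub (qri Omega1) (qri Omega2).
Proof.
apply/seteqP; split; last exact: qri_set_sub.
rewrite qreg => x /(iri_set_sub cvx1 cvx2 iri1 iri2)[a iA [b iB <-]].
by exists a; [exact: iri_sub_qri|exists b => //; exact: iri_sub_qri].
Qed.
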